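(* Let $(X,G)$ be a CR-dynamical system. Then the following hold. (1) $(X,G)$ is $1$-minimal if and only if $(X,G)$ is $1^{\oplus}$-minimal. (2) If $(X,G)$ is $1^{\oplus}$-minimal, then $(X,G)$ is $2^{\oplus}$-minimal. (3) If $(X,G)$ is $2^{\oplus}$-minimal, then $(X,G)$ is $3^{\oplus}$-minimal. (4) If $(X,G)$ is $3^{\oplus}$-minimal, then $(X,G)$ is $\infty$-minimal.
   Context: A CR-dynamical system is a pair $(X,G)$ where $X$ is a compact metric space and $G\subseteq X\times X$ is a non-empty closed subset. Let $p_1(x,y)=x$ be the first projection $X\times X\to X$. Invariance: $A\subseteq X$ is $1$-invariant in $(X,G)$ if for each $x\in A$ with $x\in p_1(G)$ there is $y\in A$ such that $(x,y)\in G$; $A$ is $\infty$-invariant in $(X,G)$ if for each $(x,y)\in G$, $x\in A$ implies $y\in A$. For $k\in\{1,\infty\}$, $(X,G)$ is $k$-minimal if every closed subset $A$ of $X$ that is $k$-invariant in $(X,G)$ satisfies $A\in\{\emptyset,X\}$. Forward orbits: $\star_{i=1}^{\infty}G=\{(x_1,x_2,x_3,\ldots)\in\prod_{i=1}^\infty X : (x_i,x_{i+1})\in G \text{ for each positive integer } i\}$, and $\pi_k$ denotes the $k$-th coordinate projection. For $x\in X$, $T_G^{+}(x)=\{\mathbf x\in\star_{i=1}^{\infty}G : \pi_1(\mathbf x)=x\}$. For $\mathbf x\in\star_{i=1}^{\infty}G$, $\mathcal O_G^{\oplus}(\mathbf x)=\{\pi_k(\mathbf x): k\ge 1\}\subseteq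 X$. For $x\in X$, $\mathcal U_G^{\oplus}(x)=\bigcup_{\mathbf x\in T_G^{+}(x)}\mathcal O_G^{\oplus}(\mathbf x)$. $\mathrm{Cl}$ denotes closure in $X$. $(X,G)$ is $1^{\oplus}$-minimal if $T_G^{+}(x)\ne\emptyset$ for each $x\in X$ and $\mathrm{Cl}(\mathcal O_G^{\oplus}(\mathbf x))=X$ for each $\mathbf x\in\star_{i=1}^{\infty}G$; it is $2^{\oplus}$-minimal if for each $x\in X$ there is $\mathbf x\in T_G^{+}(x)$ with $\mathrm{Cl}(\mathcal O_G^{\oplus}(\mathbf x))=X$; it is $3^{\oplus}$-minimal if $\mathrm{Cl}(\mathcal U_G^{\oplus}(x))=X$ for each $x\in X$. *)

(* Defs.v *)
From mathcomp Require Import all_boot all_order all_algebra.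
From mathcomp Require Import all_classical all_reals all_analysis.

Set Implicit Arguments.
Unset Strict Implicit.
Unset Printing Implicit Defensive.

Local Open Scope classical_set_scope.

Definition CR_dynamical_system (R : realType) (X : metricType R)
    (G : set (X * X)) : Prop :=
  [/\ compact [set: X], G !=set0 & closed G].

Definition p1 (X : Type) : X * X -> X := fst.

Definition one_invariant (X : Type) (G : set (X * X)) (A : set X) : Prop :=
  forall x, A x -> (@p1 X @` G) x -> exists2 y, A y & G (x, y).

Definition infty_invariant (X : Type) (G : set (X * X)) (A : set X) : Prop :=
  forall x y, G (x, y) -> A x -> A y.

Definition one_minimal (R : realType) (X : metricType R)
    (G : set (X * X)) : Prop :=
  forall A : set X, closed A -> one_invariant G A -> A = set0 \/ A = setT.

Definition infty_minimal (R : realType) (X : metricType R)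
    (G : set (X * X)) : Prop :=
  forall A : set X, closed A -> infty_invariant G A -> A = set0 \/ A = setT.

(* Sequences are indexed from 0: [u k] is the coordinate of index k + 1 in the
   usual numbering (x_1, x_2, x_3, ...). *)
Definition star (X : Type) (G : set (X * X)) : set (nat -> X) :=
  [set u | forall k, G (u k, u k.+1)].

Definition forward_trajectories (X : Type) (G : set (X * X)) (x : X) :
    set (nat -> X) :=
  [set u | star G u /\ u 0%N = x].

Definition forward_orbit (X : Type) (u : nat -> X) : set X := range u.

Definition forward_orbits_union (X : Type) (G : set (X * X)) (x : X) : set X :=
  \bigcup_(u in forward_trajectories G x) forward_orbit u.

Definition one_oplus_minimal (R : realType) (X : metricType R)
    (G : set (X * X)) : Prop :=
  (forall x, forward_trajectories G x !=set0) /\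
  (forall u, star G u -> closure (forward_orbit u) = setT).

Definition two_oplus_minimal (R : realType) (X : metricType R)
    (G : set (X * X)) : Prop :=
  forall x, exists2 u, forward_trajectories G x u &
    closure (forward_orbit u) = setT.

Definition three_oplus_minimal (R : realType) (X : metricType R)
    (G : set (X * X)) : Prop :=
  forall x, closure (forward_orbits_union G x) = setT.

(* Main.v *)
(** If [x] lies outside [p1 @` G] then [[set x]] is vacuously 1-invariant, so
    1-minimality forces every point to have a successor.  The closure [C] of a
    forward orbit is 1-invariant because the points having a successor in [C]
    form the projection of a compact subset of [G], which is closed and contains
    the orbit.  Conversely, when every point has a successor, a nonempty
    1-invariant set contains a whole forward orbit. *)
Require Import Defs.
From mathcomp Require Import all_boot all_order all_algebra.
From mathcomp Require Import all_classical all_reals all_analysis.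

Local Open Scope classical_set_scope.

(** Choice turns 1-invariance into a successor map sending [A] into itself; its iterates from [x]
    form the trajectory. *)
Lemma one_invariant_trajectory (X : Type) (G : set (X * X)) (A : set X) (x : X) :
  one_invariant G A -> A `<=` @p1 X @` G -> A x ->
  exists2 u, forward_trajectories G x u & forward_orbit u `<=` A.
Proof.
move=> Ainv AG Ax.
have [y|f fP] := @choice X X (fun y z => A y -> A z /\ G (y, z)).
  (* Outside [A] the map takes the dummy value [y], which the iterates never meet. *)
  have [Ay|nAy] := pselect (A y); last by exists y => /nAy.
  by have [z Az Gyz] := Ainv y Ay (AG y Ay); exists z.
have uA k : A (iter k f x) by elim: k => //= k /fP[].
exists (fun k => iter k f x); last by move=> _ [k _ <-].
by split=> // k; have [] := fP _ (uA k).
Qed.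

Lemma closed_predecessors (X : topologicalType) (G : set (X * X)) (C : set X) :
  hausdorff_space X -> compact [set: X] -> closed G -> closed C ->
  closed (@p1 X @` (G `&` snd @^-1` C)).
Proof.
move=> hX cX cG cC; apply: compact_closed => //.
apply: continuous_compact.
  by apply: continuous_subspaceT => z; exact: cvg_fst.
apply: (@subclosed_compact _ _ [set: X * X]) => //; last first.
  by rewrite -setXTT; exact: compact_setX.
apply: closedI => //; apply: preimage_closed => // z _; exact: cvg_snd.
Qed.

Lemma one_invariant_closure_orbit (X : topologicalType) (G : set (X * X))
    (u : nat -> X) :
  hausdorff_space X -> compact [set: X] -> closed G -> star G u ->
  one_invariant G (closure (forward_orbit u)).
Proof.
move=> hX cX cG Gu x Cx _; set C := closure _ in Cx *.
have cP := closed_predecessors X G C hX cX cG (@closed_closure _ _).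
(* The predecessors of [C] form a closed set, so [x] has a successor in [C] once it is a limit of
   such predecessors; each [u k] is one, through [u k.+1]. *)
suff /cP[[a b] [Gab Cb] /= <-] : closure (@p1 X @` (G `&` snd @^-1` C)) x.
  by exists b.
apply: closureS Cx => _ [k _ <-]; exists (u k, u k.+1) => //; split; first exact: Gu.
by apply: subset_closure; exists k.+1.
Qed.

Lemma one_minimal_p1_surj (R : realType) (X : metricType R) (G : set (X * X)) :
  G !=set0 -> one_minimal G -> @p1 X @` G = setT.
Proof.
move=> [[a b] Gab] minG; rewrite -subTset => x _.
apply: contrapT => nGx.
have x1 : one_invariant G [set x] by move=> y ->.
have cx : closed [set x].
  exact/accessible_closed_set1/hausdorff_accessible/metric_hausdorff.
have [x0|xT] := minG _ cx x1; first by have : set0 x by rewrite -x0.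
(* If [[set x]] is the whole space, the given pair of [G] starts at [x], which contradicts [nGx]. *)
have ax : a = x by have : [set: X] a by []; rewrite -xT.
by apply: nGx; exists (a, b).
Qed.

Lemma closure_in_closed_eqT (X : topologicalType) (A B : set X) :
  closed A -> B `<=` A -> closure B = setT -> A = setT.
Proof.
by move=> /closure_id cA BA BT; rewrite -subTset -BT cA; exact: closureS.
Qed.

Lemma one_minimalP (R : realType) (X : metricType R) (G : set (X * X)) :
  CR_dynamical_system G -> one_minimal G <-> one_oplus_minimal G.
Proof.
move=> [cX G0 cG]; split=> [minG|[traj orbT] A cA Ainv].
  have GT := one_minimal_p1_surj R X G G0 minG.
  split=> [x|u Gu].
    have [|||u xu _] := @one_invariant_trajectory X G setT x => //; last by exists u.
    - by move=> y _; rewrite GT -{1}GT => -[[? z] ? /= <-]; exists z.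
    - by rewrite GT.
  have uinv := one_invariant_closure_orbit X G u (@metric_hausdorff _ _) cX cG Gu.
  have [/closure_eq0 u0|//] := minG _ (@closed_closure _ _) uinv.
  by have : set0 (u 0%N) by rewrite -u0; exists 0%N.
have [->|/set0P[x Ax]] := eqVneq A set0; [by left|right].
have [|u [Gu _] uA] := @one_invariant_trajectory X G A x Ainv _ Ax.
  by move=> y _; have [v [Gv <-]] := traj y; exists (v 0%N, v 1%N).
exact: closure_in_closed_eqT cA uA (orbT u Gu).
Qed.

Theorem theorem4p8 (R : realType) (X : metricType R) (G : set (X * X))
    (hG : CR_dynamical_system G) :
  [/\ one_minimal G <-> one_oplus_minimal G,
      one_oplus_minimal G -> two_oplus_minimal G,
      two_oplus_minimal G -> three_oplus_minimal G &
      three_oplus_minimal G -> infty_minimal G].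
Proof.
split; first exact: one_minimalP.
- by move=> [traj orbT] x; have [u [Gu ux]] := traj x; exists u => //; exact: orbT.
- move=> orbT x; have [u xu uT] := orbT x.
  rewrite -subTset -uT; apply: closureS => y uy; by exists u.
- move=> UT A cA Ainv.
  have [->|/set0P[x Ax]] := eqVneq A set0; [by left|right].
  (* By induction along each trajectory from [x], the set [A] contains the dense union of the
     forward orbits of [x]. *)
  apply: closure_in_closed_eqT cA _ (UT x) => _ [u [Gu ux] [k _ <-]].
  by elim: k => [|k]; [rewrite ux|exact/Ainv/Gu].
Qed.
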